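(* Let $\bar\ell:\mathbb{R}^K\to\mathbb{R}$ be the multinomial logistic loss associated with a choice vector $(y_0,y_1,\dots,y_K)\in\{0,1\}^{K+1}$, $\sum_{i=0}^Ky_i=1$. Then for all $\mathbf{z}_1,\mathbf{z}_2\in\mathbb{R}^K$, $$e^{-3\sqrt2\|\mathbf{z}_1-\mathbf{z}_2\|_\infty}\,\nabla^2\bar\ell(\mathbf{z}_1)\preceq\nabla^2\bar\ell(\mathbf{z}_2)\preceq e^{3\sqrt2\|\mathbf{z}_1-\mathbf{z}_2\|_\infty}\,\nabla^2\bar\ell(\mathbf{z}_1).$$
   Context: The multinomial logistic loss with outside option $0$ is $\bar\ell(\mathbf{z})=-\sum_{i=0}^{K}y_i\log\left(\frac{\exp(z_i)}{1+\sum_{j=1}^K\exp(z_j)}\right)$ for $\mathbf{z}=(z_1,\dots,z_K)\in\mathbb{R}^K$, with the convention $z_0=0$. $A\preceq B$ means $B-A$ is positive semidefinite. *)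

(* Defs.v *)
From mathcomp Require Import all_boot all_order all_algebra.
From mathcomp Require Import all_classical all_reals all_analysis.
Set Implicit Arguments.
Unset Strict Implicit.
Unset Printing Implicit Defensive.
Import Order.TTheory GRing.Theory Num.Theory.
Import numFieldNormedType.Exports.
Local Open Scope ring_scope.

(* z_i for i = 0, ..., K: the vector z = (z_1, ..., z_K) is indexed by 'I_K
   (so z_(j+1) is z 0 j), extended by the convention z_0 = 0. *)
Definition utility (R : realType) (K : nat) (z : 'rV[R]_K) (i : 'I_K.+1) : R :=
  if unlift ord0 i is Some j then z 0 j else 0.

Definition mnl_loss (R : realType) (K : nat) (y : 'I_K.+1 -> bool)
    (z : 'rV[R]_K) : R :=
  - \sum_(i < K.+1)
      (y i)%:R * ln (expR (utility z i) / (1 + \sum_(j < K) expR (z 0 j))).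

Definition hessian (R : realType) (K : nat) (f : 'rV[R]_K -> R)
    (z : 'rV[R]_K) : 'M[R]_K :=
  \matrix_(i, j)
    'D_(delta_mx 0 i) (fun w : 'rV[R]_K => 'D_(delta_mx 0 j) f w) z.

Definition psd (R : realType) (K : nat) (A : 'M[R]_K) : Prop :=
  A^T = A /\ forall v : 'rV[R]_K, 0 <= (v *m A *m v^T) 0 0.

Definition loewner_le (R : realType) (K : nat) (A B : 'M[R]_K) : Prop :=
  psd (B - A).

(* Main.v *)
(* The Hessian at z is the quadratic form v |-> Var_{p(z)}(v), the variance of
   (0, v_1, ..., v_K) under the softmax probabilities p(z).  Since
   Var_p(v) = min_c sum_i p_i (v_i - c)^2 and p_i(z2) <= e^{2 d} p_i(z1) with
   d = |z1 - z2|_oo, the variances compare with the factor e^{2 d}, and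
   2 <= 3 sqrt 2. *)
Require Import Defs.
From mathcomp Require Import all_boot all_order all_algebra.
From mathcomp Require Import all_classical all_reals all_analysis.
From mathcomp Require Import ring lra.
Import Order.TTheory GRing.Theory Num.Theory.
Import numFieldNormedType.Exports.
Local Open Scope ring_scope.

(** The two difference quotients are the same function of [h]. Restricting to a line lets
    one-variable rules act on directional derivatives, so no total differential is ever needed. *)
Lemma is_derive_line {R : numFieldType} {V W : normedModType R} (f : V -> W)
    (x v : V) (df : W) :
  is_derive x v f df <-> is_derive (0 : R^o) 1 (fun h : R => f (h *: v + x)) df.
Proof.
have eD : 'D_v f x = 'D_1 (fun h : R^o => f (h *: v + x)) 0.
  rewrite /derive; set F := (F in lim (fmap F _)); set G := (G in _ = lim (fmap G _)).
  suff -> : F = G by [].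
  rewrite /F /G; apply/funext => h /=.
  by rewrite addr0 scale0r add0r [h%:A]mulr1.
by split=> -[dv <-]; split; rewrite ?eD //; [exact: (derivable1P f x v).1 | exact: (derivable1P f x v).2].
Qed.

Lemma is_derive_comp_scalar {R : realType} {V : normedModType R} (f : R -> R)
    (g : V -> R) (x v : V) (a b : R) :
  is_derive (g x) 1 f a -> is_derive x v g b -> is_derive x v (f \o g) (a * b).
Proof.
move=> fa /is_derive_line gb; apply/is_derive_line.
by apply: (@is_derive1_comp _ f); rewrite ?scale0r ?add0r.
Qed.

Lemma is_derive_utility {R : realType} {K : nat} (i : 'I_K.+1) (w v : 'rV[R]_K) :
  is_derive w v (fun z : 'rV[R]_K => utility z i) (utility v i).
Proof.
apply/is_derive_line.
rewrite /utility; case: unlift => [j|]; last exact: is_derive_cst.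
have -> : (fun h : R => (h *: v + w) 0 j) = v 0 j \*: id + cst (w 0 j).
  by apply/funext => h; rewrite !mxE/= mulrC.
apply: is_derive_eq.
by rewrite addr0 [_ *: _]mulr1.
Qed.

Definition log_partition {R : realType} {K : nat} (z : 'rV[R]_K) : R :=
  ln (\sum_(i < K.+1) expR (utility z i)).

(** The softmax weight, kept as a single exponential: its derivative is then one chain rule, and
    comparing two weights amounts to comparing exponents. *)
Definition choice_prob {R : realType} {K : nat} (z : 'rV[R]_K) (i : 'I_K.+1) : R :=
  expR (utility z i - log_partition z).

Definition choice_mean {R : realType} {K : nat} (z : 'rV[R]_K) (v : 'rV[R]_K) : R :=
  \sum_(i < K.+1) choice_prob z i * utility v i.

Section ChoiceModel.
Context {R : realType} {K : nat}.
Implicit Types (y : 'I_K.+1 -> bool) (z v w : 'rV[R]_K).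

Lemma partition_gt0 z : 0 < \sum_(i < K.+1) expR (utility z i).
Proof.
rewrite big_ord_recl; apply: ltr_wpDr; last exact: expR_gt0.
by apply: sumr_ge0 => i _; exact: expR_ge0.
Qed.

Lemma choice_probE z i :
  choice_prob z i = expR (utility z i) / \sum_(j < K.+1) expR (utility z j).
Proof. by rewrite /choice_prob expRB lnK // posrE; exact: partition_gt0. Qed.

Lemma choice_prob_sum z : \sum_(i < K.+1) choice_prob z i = 1.
Proof.
under eq_bigr do rewrite choice_probE.
by rewrite -mulr_suml divff // gt_eqF // partition_gt0.
Qed.

Lemma is_derive_log_partition w v :
  is_derive w v (@log_partition R K) (choice_mean w v).
Proof.
have -> : @log_partition R K =
    @ln R \o \sum_(i < K.+1) (expR \o (fun z => utility z i)).
  by apply/funext => z /=; rewrite /log_partition fct_sumE.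
apply: is_derive_eq.
  apply: is_derive_comp_scalar.
    apply: is_derive1_ln; rewrite fct_sumE; exact: partition_gt0.
  apply: is_derive_sum => i.
  by apply: is_derive_comp_scalar; exact: is_derive_utility.
rewrite mulr_sumr; apply: eq_bigr => i _.
by rewrite choice_probE fct_sumE/=; ring.
Qed.

Lemma is_derive_choice_prob i w v :
  is_derive w v (fun z => choice_prob z i)
    (choice_prob w i * (utility v i - choice_mean w v)).
Proof.
apply: (@is_derive_comp_scalar _ _ expR
  ((fun z => utility z i) - @log_partition R K)).
apply: is_deriveB; [exact: is_derive_utility | exact: is_derive_log_partition].
Qed.

(** As the entries of [y] sum to 1, the log-partition enters with total weight 1. The choice vector
    survives only in a linear term, so the second derivatives do not see it. *)
Lemma mnl_lossE y : (\sum_(i < K.+1) y i)%N = 1%N ->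
  mnl_loss y = @log_partition R K -
    \sum_(i < K.+1) (y i)%:R \*: (fun z : 'rV[R]_K => utility z i).
Proof.
move=> y1; apply/funext => z; rewrite /mnl_loss.
have -> : 1 + \sum_(j < K) expR (z 0 j) = \sum_(i < K.+1) expR (utility z i).
  rewrite big_ord_recl /utility unlift_none expR0; congr (_ + _).
  by apply: eq_bigr => j _; rewrite liftK.
under eq_bigr do rewrite -choice_probE expRK mulrBr.
rewrite sumrB -mulr_suml -natr_sum y1 mul1r opprB.
by rewrite [RHS]/= fct_sumE.
Qed.

Lemma derive_mnl_loss y w v : (\sum_(i < K.+1) y i)%N = 1%N ->
  'D_v (mnl_loss y) w =
    choice_mean w v - \sum_(i < K.+1) (y i)%:R * utility v i.
Proof.
move=> /mnl_lossE ->; apply: derive_val.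
apply: is_deriveB; first exact: is_derive_log_partition.
apply: is_derive_sum => i; apply: is_deriveZ; exact: is_derive_utility.
Qed.

Lemma choice_mean_delta z j :
  choice_mean z (delta_mx 0 j) = choice_prob z (lift ord0 j).
Proof.
rewrite /choice_mean big_ord_recl {1}/utility unlift_none mulr0 add0r.
rewrite (bigD1 j) //= big1 => [|k kj]; rewrite /utility liftK !mxE/=.
  by rewrite eqxx mulr1 addr0.
by rewrite (negbTE kj) mulr0.
Qed.

Lemma hessian_mnl_lossE y z i j : (\sum_(i < K.+1) y i)%N = 1%N ->
  hessian (mnl_loss y) z i j = choice_prob z (lift ord0 i) * (i == j)%:R -
    choice_prob z (lift ord0 i) * choice_prob z (lift ord0 j).
Proof.
(* [c] is the contribution of [y] to the gradient; it does not depend on the point and vanishes at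
   the second differentiation. *)
move=> y1; rewrite mxE; set c := \sum_(k < K.+1) (y k)%:R *
  utility (delta_mx 0 j : 'rV[R]_K) k.
have -> : (fun w => 'D_(delta_mx 0 j) (mnl_loss y) w) =
    (fun z => choice_prob z (lift ord0 j)) - cst c.
  by apply/funext => w; rewrite derive_mnl_loss // choice_mean_delta.
apply: derive_val; apply: is_derive_eq.
  by apply: is_deriveB; exact: is_derive_choice_prob.
rewrite choice_mean_delta /utility liftK mxE eqxx /= subr0 eq_sym.
by case: eqVneq => [->|_] /=; ring.
Qed.

Lemma hessian_mnl_loss_sym y z : (\sum_(i < K.+1) y i)%N = 1%N ->
  (hessian (mnl_loss y) z)^T = hessian (mnl_loss y) z.
Proof.
move=> y1; apply/matrixP => i j; rewrite mxE !hessian_mnl_lossE // [j == i]eq_sym.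
by case: eqVneq => [->|_] /=; ring.
Qed.

Lemma hessian_mnl_loss_form y z v : (\sum_(i < K.+1) y i)%N = 1%N ->
  (v *m hessian (mnl_loss y) z *m v^T) 0 0 =
    \sum_(i < K.+1) choice_prob z i * (utility v i - choice_mean z v) ^+ 2.
Proof.
move=> y1; set m := choice_mean z v.
have mE : m = \sum_(j < K) choice_prob z (lift ord0 j) * v 0 j.
  rewrite /m /choice_mean big_ord_recl {1}/utility unlift_none mulr0 add0r.
  by apply: eq_bigr => j _; rewrite /utility liftK.
(* Variance as second moment minus squared mean; this uses that the weights have total mass 1. *)
have -> : \sum_(i < K.+1) choice_prob z i * (utility v i - m) ^+ 2 =
    \sum_(i < K.+1) choice_prob z i * utility v i ^+ 2 - m ^+ 2.
  transitivity (\sum_(i < K.+1) (choice_prob z i * utility v i ^+ 2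
      - 2 * m * (choice_prob z i * utility v i) + m ^+ 2 * choice_prob z i)).
    by apply: eq_bigr => i _; ring.
  rewrite big_split /= sumrB -!mulr_sumr choice_prob_sum.
  by rewrite -/(choice_mean z v) -/m; ring.
(* The outside option has utility 0 and drops out of the second moment, leaving sums over ['I_K] to
   match with the matrix product term by term. *)
rewrite big_ord_recl {1}/utility unlift_none expr0n mulr0 add0r.
rewrite mxE expr2 {2}mE mulr_sumr -sumrB; apply: eq_bigr => j _.
rewrite /utility liftK [v^T _ _]mxE [(v *m _) _ _]mxE mE.
under eq_bigr do rewrite hessian_mnl_lossE // mulrBr.
rewrite sumrB (bigD1 j) //= big1 => [|k /negbTE kj]; last by rewrite kj !mulr0.
rewrite eqxx mulr1 addr0 mulrBl; congr (_ - _); first by ring.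
by rewrite !mulr_suml; apply: eq_bigr => k _; ring.
Qed.

Lemma utility_le_norm v i : `|utility v i| <= `|v|.
Proof.
rewrite /utility; case: unlift => [j|]; last by rewrite normr0.
rewrite [leRHS]mx_normrE; exact: (le_bigmax _ (fun ij => `|v ij.1 ij.2|) (0, j)).
Qed.

Lemma utility_le z1 z2 i : utility z2 i <= `|z1 - z2| + utility z1 i.
Proof.
rewrite -lerBlDr distrC; apply: le_trans (utility_le_norm (z2 - z1) i).
apply: le_trans (ler_norm _).
by rewrite /utility; case: unlift => [j|]; rewrite ?mxE ?subr0.
Qed.

(** Each summand grows by a factor of at most [expR] of the sup distance, hence so does the sum. *)
Lemma log_partition_le z1 z2 :
  log_partition z2 <= `|z1 - z2| + log_partition z1.
Proof.
rewrite /log_partition -[X in X + _]expRK -lnM ?posrE ?expR_gt0 ?partition_gt0 //.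
rewrite ler_ln ?posrE ?mulr_gt0 ?expR_gt0 ?partition_gt0 // mulr_sumr.
by apply: ler_sum => i _; rewrite -expRD ler_expR utility_le.
Qed.

Lemma choice_prob_le z1 z2 i :
  choice_prob z2 i <= expR (2 * `|z1 - z2|) * choice_prob z1 i.
Proof.
rewrite -expRD ler_expR.
(* The log-partition enters with a minus sign, so its bound is taken with [z1] and [z2] exchanged.
   Numerator and denominator each cost one distance, whence the factor 2. *)
have := utility_le z1 z2 i; have := log_partition_le z2 z1; rewrite distrC.
by lra.
Qed.

(** With [m] the mean, the gap between the two sides is exactly [(m - c) ^+ 2]. *)
Lemma choice_variance_le z v c :
  \sum_(i < K.+1) choice_prob z i * (utility v i - choice_mean z v) ^+ 2 <=
  \sum_(i < K.+1) choice_prob z i * (utility v i - c) ^+ 2.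
Proof.
set m := choice_mean z v; rewrite -subr_ge0 -sumrB.
have -> : \sum_(i < K.+1) (choice_prob z i * (utility v i - c) ^+ 2 -
    choice_prob z i * (utility v i - m) ^+ 2) = (m - c) ^+ 2.
  transitivity (\sum_(i < K.+1) (2 * (m - c) * (choice_prob z i * utility v i) +
      (c ^+ 2 - m ^+ 2) * choice_prob z i)).
    by apply: eq_bigr => i _; ring.
  rewrite big_split /= -!mulr_sumr choice_prob_sum -/(choice_mean z v) -/m.
  by ring.
exact: sqr_ge0.
Qed.

Lemma hessian_mnl_loss_form_le y z1 z2 v (a : R) :
    (\sum_(i < K.+1) y i)%N = 1%N -> 2 * `|z1 - z2| <= a ->
  (v *m hessian (mnl_loss y) z2 *m v^T) 0 0 <=
    expR a * (v *m hessian (mnl_loss y) z1 *m v^T) 0 0.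
Proof.
move=> y1 le_a.
rewrite [leLHS]hessian_mnl_loss_form // [X in _ <= _ * X]hessian_mnl_loss_form //.
(* Recentring the variance under [z2] at the mean under [z1] makes the squares on both sides equal,
   so only the weights remain to be compared, term by term. *)
apply: le_trans (choice_variance_le z2 v (choice_mean z1 v)) _.
rewrite mulr_sumr; apply: ler_sum => i _.
rewrite [leRHS]mulrA; apply: ler_wpM2r; first exact: sqr_ge0.
apply: le_trans (choice_prob_le z1 z2 i) _.
by rewrite ler_wpM2r ?expR_ge0 // ler_expR.
Qed.

End ChoiceModel.

Lemma loewner_leP {R : realType} {K : nat} (A B : 'M[R]_K) :
  A^T = A -> B^T = B ->
  (forall v : 'rV[R]_K, (v *m A *m v^T) 0 0 <= (v *m B *m v^T) 0 0) ->
  loewner_le A B.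
Proof.
move=> symA symB leAB; split; first by rewrite linearB /= symA symB.
by move=> v; rewrite mulmxBr mulmxBl !mxE subr_ge0; have := leAB v; rewrite !mxE.
Qed.

(* The norm `|_| on 'rV[R]_K is the sup norm (mx_norm). *)
Theorem propositionB5 (R : realType) (K : nat) (y : 'I_K.+1 -> bool)
    (hy : (\sum_(i < K.+1) y i)%N = 1%N) (z1 z2 : 'rV[R]_K) :
  loewner_le (expR (- (3 * Num.sqrt 2 * `|z1 - z2|)) *: hessian (mnl_loss y) z1)
             (hessian (mnl_loss y) z2) /\
  loewner_le (hessian (mnl_loss y) z2)
             (expR (3 * Num.sqrt 2 * `|z1 - z2|) *: hessian (mnl_loss y) z1).
Proof.
set a := 3 * Num.sqrt 2 * `|z1 - z2|.
have sqrt2_ge1 : 1 <= Num.sqrt 2 :> R.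
  by rewrite -[leLHS]sqrtr1 ler_sqrt ?ler1n.
have le_a : 2 * `|z1 - z2| <= a by rewrite ler_wpM2r //; lra.
have symH z := hessian_mnl_loss_sym y z hy.
have symZ (b : R) z : (b *: hessian (mnl_loss y) z)^T = b *: hessian (mnl_loss y) z.
  by rewrite linearZ /= symH.
split; apply: loewner_leP => // v.
  (* The lower bound is the upper bound with [z1] and [z2] exchanged, once the negative exponential
     is moved across as [expR a]. *)
  rewrite -scalemxAr -scalemxAl [leLHS]mxE expRN mulrC ler_pdivrMr ?expR_gt0 // mulrC.
  by apply: hessian_mnl_loss_form_le => //; rewrite distrC.
by rewrite -scalemxAr -scalemxAl [leRHS]mxE; exact: hessian_mnl_loss_form_le.
Qed.
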